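(* Consider a sequence of experiments indexed by the sample size $n$ in which, for each $n$, treatment is assigned by complete randomization (with a fixed $p\in(0,1)$), and suppose the regularity conditions (Assumption R in the context) hold. If $d_{\mathrm{avg}}=o(n)$ and $C_1=o(n^{1/2})$, then the Horvitz–Thompson estimator $\hat\tau_{HT}$ and the Hájek estimator $\hat\tau_{HA}$ are consistent for $\tau_{EATE}$ (i.e. their differences from $\tau_{EATE}$ converge to $0$ in probability as $n\to\infty$), and $$\hat\tau_{HT}-\tau_{EATE}=O_p\big(n^{-1/2}d_{\mathrm{avg}}^{1/2}+n^{-1/2}C_1\big),\qquad \hat\tau_{HA}-\tau_{EATE}=O_p\big(n^{-1/2}d_{\mathrm{avg}}^{1/2}+n^{-1/2}C_1\big).$$
   Context: Setting. For each sample size $n$ there are units $U=\{1,\dots,n\}$ and arbitrary potential outcome functions $y_i:\{0,1\}^n\to\mathbb R$, $i\in U$. For $\mathbf z\in\{0,1\}^n$, $\mathbf z_{-i}\in\{0,1\}^{n-1}$ is $\mathbf z$ with its $i$th entry deleted, and $y_i(\mathbf z)$ is also written $y_i(z_i;\mathbf z_{-i})$. An experimental design is the probability distribution of a random vector $\mathbf Z=(Z_1,\dots,Z_n)\in\{0,1\}^n$; it is the only source of randomness. Write $Y_i=y_i(\mathbf Z)$ and $p_i=\Pr(Z_i=1)$. All objects depend on $n$, with no relation assumed between different $n$; asymptotics are as $n\to\infty$. Assumption R (regularity conditions). There are constants $k<\infty$, $q\ge 2$, $s\ge 1$ such that for all $n$ and all $i\in U$: $k^{-1}\le \Pr(Z_i=1)\le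 1-k^{-1}$; $E[|Y_i|^q]\le k^q$; and $E[|y_i(z;\mathbf Z_{-i})|^s]\le k^s$ for $z\in\{0,1\}$. Complete randomization: for a fixed $p\in(0,1)$ and $m=\lfloor pn\rfloor$, $\Pr(\mathbf Z=\mathbf z)=\binom nm^{-1}$ if $\sum_i z_i=m$, and $0$ otherwise. Interference. $I_{ij}=1$ if $i=j$ or if $y_j(\mathbf z)\ne y_j(\mathbf z')$ for some $\mathbf z,\mathbf z'\in\{0,1\}^n$ with $\mathbf z_{-i}=\mathbf z'_{-i}$; otherwise $I_{ij}=0$. $d_{ij}=1$ if $I_{\ell i}I_{\ell j}=1$ for some $\ell\in U$, else $d_{ij}=0$; $d_{\mathrm{avg}}=n^{-1}\sum_{i=1}^n\sum_{j=1}^n d_{ij}$. $C_1=n^{-1}\sum_{i=1}^n\sum_{j=1}^n I_{ij}$. Estimand: $\tau_{EATE}=n^{-1}\sum_{i=1}^n E[y_i(1;\mathbf Z_{-i})-y_i(0;\mathbf Z_{-i})]$, expectation over the (unconditional) design. Estimators: $\hat\tau_{HT}=\frac1n\sum_i \frac{Z_iY_i}{p_i}-\frac1n\sum_i\frac{(1-Z_i)Y_i}{1-p_i}$ and $\hat\tau_{HA}=\Big(\sum_i\frac{Z_iY_i}{p_i}\Big/\sum_i\frac{Z_i}{p_i}\Big)-\Big(\sum_i\frac{(1-Z_i)Y_i}{1-p_i}\Big/\sum_i\frac{1-Z_i}{1-p_i}\Big)$. $X_n=O_p(a_n)$ means that for every $\varepsilon>0$ there is $M<\infty$ with $\Pr(|X_n|>M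 a_n)\le\varepsilon$ for all sufficiently large $n$. *)

(* Defs.v *)
From HB Require Import structures.
From mathcomp Require Import all_boot all_order all_algebra.
From mathcomp Require Import all_classical all_reals all_analysis.

Set Implicit Arguments.
Unset Strict Implicit.
Unset Printing Implicit Defensive.

Import Order.TTheory GRing.Theory Num.Theory.
Import numFieldNormedType.Exports.

Local Open Scope classical_set_scope.
Local Open Scope ring_scope.

Definition assignment (n : nat) := {ffun 'I_n -> bool}.

(* z_{-i}: the i-th entry of z is deleted; 'lift i' enumerates the other
   units in increasing order. *)
Definition delete_entry (n : nat) (i : 'I_n) (z : assignment n) :
    assignment n.-1 :=
  [ffun j => z (lift i j)].

(* The assignment (b; w) that has b at unit i and w at the other units. *)
Definition insert_entry (n : nat) (i : 'I_n) (b : bool) (w : assignment n.-1) :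
    assignment n :=
  [ffun j => if unlift i j is Some j' then w j' else b].

Record design (R : realType) (n : nat) := Design {
  mass :> assignment n -> R;
  mass_ge0 : forall z, 0 <= mass z;
  mass_sum1 : \sum_z mass z = 1 }.

Definition Pr (R : realType) (n : nat) (D : design R n)
    (A : pred (assignment n)) : R :=
  \sum_(z | A z) D z.

Definition Expect (R : realType) (n : nat) (D : design R n)
    (X : assignment n -> R) : R :=
  \sum_z D z * X z.

Definition treat_prob (R : realType) (n : nat) (D : design R n) (i : 'I_n) : R :=
  Pr D (fun z => z i).

Definition outcomes (R : realType) (n : nat) := 'I_n -> assignment n -> R.

(* y_i(b; Z_{-i}) as a function of the realized assignment z. *)
Definition outcome_at (R : realType) (n : nat) (y : outcomes R n) (i : 'I_n)
    (b : bool) (z : assignment n) : R :=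
  y i (insert_entry i b (delete_entry i z)).

Definition complete_randomization (R : realType) (p : R) (n : nat)
    (D : design R n) : Prop :=
  let m := Num.truncn (p * n%:R) in
  forall z : assignment n,
    D z = if (\sum_i z i == m)%N then ('C(n, m))%:R^-1 else 0.

Definition regular_at (R : realType) (k q s : R) (n : nat) (D : design R n)
    (y : outcomes R n) : Prop :=
  forall i : 'I_n,
    [/\ k^-1 <= treat_prob D i <= 1 - k^-1,
        Expect D (fun z => `|y i z| `^ q) <= k `^ q &
        forall b : bool, Expect D (fun z => `|outcome_at y i b z| `^ s) <= k `^ s].

(* The bounds are required for all large n only: under complete randomization
   with m = floor(p n), Pr(Z_i = 1) = m / n is 0 when p n < 1, so no constant k
   could satisfy the first bound at every n. *)
Definition regularity_conditions (R : realType) (D : forall n, design R n)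
    (y : forall n, outcomes R n) : Prop :=
  exists k q s : R, [/\ 0 < k, 2 <= q, 1 <= s &
    \forall n \near \oo, regular_at k q s (D n) (y n)].

(* interferes y i j is I_ij: unit i's treatment affects unit j's outcome. *)
Definition interferes (R : realType) (n : nat) (y : outcomes R n)
    (i j : 'I_n) : bool :=
  (i == j) ||
  [exists z : assignment n, exists z' : assignment n,
     (delete_entry i z == delete_entry i z') && (y j z != y j z')].

Definition dependent (R : realType) (n : nat) (y : outcomes R n)
    (i j : 'I_n) : bool :=
  [exists l : 'I_n, interferes y l i && interferes y l j].

Definition avg_dependence (R : realType) (n : nat) (y : outcomes R n) : R :=
  n%:R^-1 * \sum_i \sum_j (dependent y i j)%:R.

Definition avg_interference (R : realType) (n : nat) (y : outcomes R n) : R :=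
  n%:R^-1 * \sum_i \sum_j (interferes y i j)%:R.

Definition tau_EATE (R : realType) (n : nat) (D : design R n)
    (y : outcomes R n) : R :=
  n%:R^-1 *
  \sum_i Expect D (fun z => outcome_at y i true z - outcome_at y i false z).

Definition tau_HT (R : realType) (n : nat) (D : design R n) (y : outcomes R n)
    (z : assignment n) : R :=
  n%:R^-1 * (\sum_i (z i)%:R * y i z / treat_prob D i)
  - n%:R^-1 * (\sum_i (1 - (z i)%:R) * y i z / (1 - treat_prob D i)).

Definition tau_HA (R : realType) (n : nat) (D : design R n) (y : outcomes R n)
    (z : assignment n) : R :=
  (\sum_i (z i)%:R * y i z / treat_prob D i)
    / (\sum_i (z i)%:R / treat_prob D i)
  - (\sum_i (1 - (z i)%:R) * y i z / (1 - treat_prob D i))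
    / (\sum_i (1 - (z i)%:R) / (1 - treat_prob D i)).

Definition cvg_in_prob0 (R : realType) (D : forall n, design R n)
    (X : forall n, assignment n -> R) : Prop :=
  forall eps : R, 0 < eps ->
    Pr (D n) (fun z => eps < `|X n z|) @[n --> \oo] --> (0 : R).

Definition bigO_in_prob (R : realType) (D : forall n, design R n)
    (X : forall n, assignment n -> R) (a : nat -> R) : Prop :=
  forall eps : R, 0 < eps -> exists M : R,
    \forall n \near \oo, Pr (D n) (fun z => M * a n < `|X n z|) <= eps.

(* Main.v *)
(* Let N_i be the set of units whose treatment affects Y_i, a_i = #|N_i|,
   and let W_i be the i-th term of the Horvitz-Thompson estimator, a function of Z on
   N_i with bounded second moment. Everything rests on one exchangeability identity:
   if u depends only on the entries of Z in S and t is not in S, then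
   (n - #|S|) E[u Z_t] = E[u (m - sum of Z over S)].
   It bounds the bias, |E W_i - tau_i| = O(a_i / n). It also bounds the effect of
   revealing #|A| further entries on the conditional probability of Z_t by O(#|A| / n);
   averaging out the entries of B one at a time then gives
   Cov(f(Z_A), g(Z_B)) = O(#|A| #|B| / n) for disjoint A and B. Pairs with d_ij = 1
   contribute O(1) each, so the mean squared error is O(d_avg / n + C_1^2 / n), and
   Markov's inequality concludes. Under complete randomization the Hajek denominators
   are deterministic, so both estimators coincide almost surely. *)
Require Import Defs.
From HB Require Import structures.
From mathcomp Require Import all_boot all_order all_algebra.
From mathcomp Require Import all_classical all_reals all_analysis.
From mathcomp Require Import perm ring lra.

Set Implicit Arguments.
Unset Strict Implicit.
Unset Printing Implicit Defensive.

Import Order.TTheory GRing.Theory Num.Theory.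
Import numFieldNormedType.Exports.

Local Open Scope classical_set_scope.
Local Open Scope ring_scope.

(** * Expectations under a finite design: linearity and second moments *)

Section Expectation.
Context (R : realType) (n : nat) (D : design R n).
Implicit Types X Y : assignment n -> R.

(** Agreement is asked only on the support of [D], so that the fixed number of treated units can be
    used under an expectation. *)
Lemma eq_Expect X Y : (forall z, D z != 0 -> X z = Y z) ->
  Expect D X = Expect D Y.
Proof.
move=> XY; apply: eq_bigr => z _.
by have [->|/XY->//] := eqVneq (D z) 0; rewrite !mul0r.
Qed.

Lemma le_Expect X Y : (forall z, D z != 0 -> X z <= Y z) ->
  Expect D X <= Expect D Y.
Proof.
move=> XY; apply: ler_sum => z _.
have [->|/XY ?] := eqVneq (D z) 0; first by rewrite !mul0r.
by rewrite ler_wpM2l // mass_ge0.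
Qed.

Lemma ExpectD X Y :
  Expect D (fun z => X z + Y z) = Expect D X + Expect D Y.
Proof. by rewrite -big_split; apply: eq_bigr => z _; rewrite mulrDr. Qed.

Lemma ExpectZ a X : Expect D (fun z => a * X z) = a * Expect D X.
Proof. by rewrite mulr_sumr; apply: eq_bigr => z _; rewrite mulrCA. Qed.

Lemma ExpectB X Y :
  Expect D (fun z => X z - Y z) = Expect D X - Expect D Y.
Proof. by rewrite -sumrB; apply: eq_bigr => z _; rewrite mulrBr. Qed.

Lemma Expect_cst a : Expect D (fun=> a) = a.
Proof. by rewrite /Expect -mulr_suml mass_sum1 mul1r. Qed.

(** Covariance plus product of biases; needed because the error terms are centred at the unit
    effects [a], [b] and not at their means. *)
Lemma Expect_mulB X Y a b :
  Expect D (fun z => (X z - a) * (Y z - b)) =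
  (Expect D (fun z => X z * Y z) - Expect D X * Expect D Y)
  + (Expect D X - a) * (Expect D Y - b).
Proof.
have bX : Expect D (fun z => b * X z) = b * Expect D X := ExpectZ _ _.
have aY : Expect D (fun z => a * Y z) = a * Expect D Y := ExpectZ _ _.
transitivity (Expect D (fun z => X z * Y z - b * X z - a * Y z + a * b)).
  by apply: eq_Expect => z _; ring.
by rewrite ExpectD !ExpectB bX aY Expect_cst; ring.
Qed.

Lemma Expect_sum (I : Type) (r : seq I) (P : pred I) (F : I -> assignment n -> R) :
  Expect D (fun z => \sum_(i <- r | P i) F i z) =
  \sum_(i <- r | P i) Expect D (F i).
Proof.
by rewrite /Expect exchange_big; apply: eq_bigr => z _; rewrite mulr_sumr.
Qed.

Lemma Expect_ge0 X : (forall z, 0 <= X z) -> 0 <= Expect D X.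
Proof.
by move=> X0; apply: sumr_ge0 => z _; rewrite mulr_ge0 // mass_ge0.
Qed.

Lemma normr_Expect X : `|Expect D X| <= Expect D (fun z => `|X z|).
Proof.
apply: le_trans (ler_norm_sum _ _ _) _; apply: ler_sum => z _.
by rewrite normrM ger0_norm // mass_ge0.
Qed.

Lemma sqr_Expect X : Expect D X ^+ 2 <= Expect D (fun z => X z ^+ 2).
Proof.
have : 0 <= Expect D (fun z => (X z - Expect D X) ^+ 2).
  by apply: Expect_ge0 => z; exact: sqr_ge0.
set e := Expect D X.
rewrite (@eq_Expect _ (fun z => X z ^+ 2 - (2 * e) * X z + e ^+ 2)); last first.
  by move=> z _; ring.
by rewrite ExpectD ExpectB ExpectZ Expect_cst -/e; nra.
Qed.

(** From [2|xy| <= x^2 + y^2]. With one common bound on both second moments this is as strong as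
    Cauchy-Schwarz. *)
Lemma normr_ExpectM X Y : `|Expect D (fun z => X z * Y z)| <=
  (Expect D (fun z => X z ^+ 2) + Expect D (fun z => Y z ^+ 2)) / 2.
Proof.
apply: le_trans (normr_Expect _) _.
rewrite -ExpectD mulrC -ExpectZ; apply: le_Expect => z _.
rewrite normrM -(real_normK (num_real (X z))) -(real_normK (num_real (Y z))).
have := sqr_ge0 (`|X z| - `|Y z|); nra.
Qed.

Lemma markov_sqr X e : 0 < e ->
  Pr D (fun z => e < `|X z|) <= Expect D (fun z => X z ^+ 2) / e ^+ 2.
Proof.
move=> e0; rewrite ler_pdivlMr ?exprn_gt0 // /Pr big_mkcond mulr_suml.
apply: ler_sum => z _.
case: ifPn => [eX|_]; last by rewrite mul0r mulr_ge0 ?mass_ge0 ?sqr_ge0.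
rewrite ler_wpM2l ?mass_ge0 // -(real_normK (num_real (X z))).
by rewrite lerXn2r ?nnegrE ?normr_ge0 ?(ltW e0) // ltW.
Qed.

End Expectation.

(** * Overwriting one entry, and functions of a subset of the entries *)

Section Entries.
Context (R : realType) (n : nat).

Lemma set_entryE (i : 'I_n) b (z : assignment n) (j : 'I_n) :
  insert_entry i b (delete_entry i z) j = if j == i then b else z j.
Proof.
rewrite /insert_entry /delete_entry ffunE.
by case: unliftP => [j' ->|->]; rewrite ?ffunE ?eqxx // eq_sym (negbTE (neq_lift _ _)).
Qed.

Lemma set_entry_id (i : 'I_n) (z : assignment n) :
  insert_entry i (z i) (delete_entry i z) = z.
Proof. by apply/ffunP => j; rewrite set_entryE; case: eqP => [->|]. Qed.

(** Plays the role of measurability with respect to the entries of Z in [S]. *)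
Definition depends_on (S : {set 'I_n}) (u : assignment n -> R) :=
  forall z z' : assignment n, {in S, z =1 z'} -> u z = u z'.

Lemma depends_on_set_entry (S : {set 'I_n}) u (t : 'I_n) b : depends_on S u ->
  depends_on (S :\ t) (fun z => u (insert_entry t b (delete_entry t z))).
Proof.
move=> uS z z' zz'; apply: uS => j jS; rewrite !set_entryE.
by case: eqP => // /eqP jt; apply: zz'; rewrite !inE jt.
Qed.

Definition treated (S : {set 'I_n}) (z : assignment n) : R :=
  \sum_(j in S) (z j)%:R.

Lemma treated_dep S : depends_on S (treated S).
Proof. by move=> z z' zz'; apply: eq_bigr => i /zz' ->. Qed.

Lemma treated_ge0 S z : 0 <= treated S z.
Proof. by apply: sumr_ge0 => i _; rewrite ler0n. Qed.

Lemma treated_le S z : treated S z <= #|S|%:R.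
Proof.
rewrite -sumr_const; apply: ler_sum => i _; by rewrite lern1 leq_b1.
Qed.

Lemma natr_cardC (S : {set 'I_n}) : n%:R - #|S|%:R = #|~: S|%:R :> R.
Proof. by rewrite -{1}[n]card_ord -(cardsC S) natrD addrAC subrr add0r. Qed.

End Entries.

(** * Exchangeability and sequential draws in a simple random sample *)

Section SimpleRandomSample.
Context (R : realType) (n : nat) (D : design R n) (m : nat) (w : R).
Hypothesis Dw : forall z, D z = if (\sum_i z i == m)%N then w else 0.
Implicit Types (S A B : {set 'I_n}) (u f g : assignment n -> R).

Lemma support_treated z : D z != 0 -> \sum_i (z i)%:R = m%:R :> R.
Proof.
rewrite Dw; have [<- _|_] := eqVneq (\sum_i z i)%N m; last by rewrite eqxx.
by rewrite natr_sum.
Qed.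

Lemma treatedC S z : D z != 0 -> m%:R - treated R S z = treated R (~: S) z.
Proof.
move=> Dz; rewrite -(support_treated Dz) [X in X - _](bigID (mem S)) /= /treated.
by rewrite addrAC subrr add0r; apply: eq_bigl => j; rewrite inE.
Qed.

(** Transposing two coordinates keeps the number of treated units, hence the mass. *)
Lemma Expect_swap u (t j : 'I_n) :
  Expect D u = Expect D (fun z => u [ffun i => z (tperm t j i)]).
Proof.
pose h (z : assignment n) : assignment n := [ffun i => z (tperm t j i)].
have hI : involutive h by move=> z; apply/ffunP => i; rewrite !ffunE tpermK.
rewrite /Expect (reindex_inj (inv_inj hI)); apply: eq_bigr => z _.
congr (_ * _); rewrite !Dw; congr (if _ == m then _ else _).
rewrite [RHS](reindex_inj (@perm_inj _ (tperm t j))).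
by apply: eq_bigr => i _; rewrite ffunE.
Qed.

(* Conditionally on the entries in [S], the remaining entries are exchangeable
   with sum [m - treated S], which gives E[Z_t | Z_S]. *)
Lemma Expect_draw S u (t : 'I_n) : depends_on S u -> t \notin S ->
  (n%:R - #|S|%:R) * Expect D (fun z => u z * (z t)%:R) =
  Expect D (fun z => u z * (m%:R - treated R S z)).
Proof.
move=> uS tS.
transitivity (\sum_(j in ~: S) Expect D (fun z => u z * (z j)%:R)).
  rewrite (eq_bigr (fun=> Expect D (fun z => u z * (z t)%:R))).
    rewrite sumr_const -[RHS]mulr_natl; congr (_ * _).
    by rewrite natr_cardC.
  move=> j; rewrite inE => jS; rewrite (Expect_swap _ t j).
  apply: eq_Expect => z _; rewrite ffunE tpermR; congr (_ * _).
  apply: uS => i iS; rewrite ffunE tpermD //.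
    by apply: contraNneq tS => ->.
  by apply: contraNneq jS => ->.
rewrite -Expect_sum; apply: eq_Expect => z Dz; rewrite -mulr_sumr.
by rewrite treatedC.
Qed.

(** The conditional probability of [Z_t = 1] given the entries in [S], the same for every [t]
    outside [S]. *)
Definition draw_prob S z : R := (m%:R - treated R S z) / (n%:R - #|S|%:R).

Lemma draw_prob_dep S : depends_on S (draw_prob S).
Proof. by move=> z z' zz'; rewrite /draw_prob (treated_dep _ zz'). Qed.

Lemma ltr_card S (t : 'I_n) : t \notin S -> #|S|%:R < n%:R :> R.
Proof.
move=> tS; rewrite -subr_gt0 natr_cardC ltr0n; apply/card_gt0P.
by exists t; rewrite inE.
Qed.

(** On the support the numerator counts the treated units outside [S], and the denominator counts
    all units outside [S]. *)
Lemma draw_prob_ge0_le1 S z (t : 'I_n) : t \notin S -> D z != 0 ->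
  0 <= draw_prob S z <= 1.
Proof.
move=> tS Dz; have nS := ltr_card tS; rewrite /draw_prob.
rewrite treatedC //.
rewrite divr_ge0 ?treated_ge0 ?subr_ge0 ?(ltW nS) //=.
rewrite ler_pdivrMr ?subr_gt0 // mul1r; apply: le_trans (treated_le _ _ _) _.
by rewrite natr_cardC.
Qed.

Lemma Expect_draw_centered S u (t : 'I_n) : depends_on S u -> t \notin S ->
  Expect D (fun z => u z * ((z t)%:R - draw_prob S z)) = 0.
Proof.
move=> uS tS; have nS := ltr_card tS.
have N0 : n%:R - #|S|%:R != 0 :> R by rewrite subr_eq0 gt_eqF.
apply: (mulfI N0); rewrite mulr0.
under [Expect _ _]eq_Expect do rewrite mulrBr.
rewrite ExpectB mulrBr Expect_draw // -ExpectZ -ExpectB.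
rewrite -[RHS](Expect_cst D); apply: eq_Expect => z _.
by rewrite /draw_prob; field.
Qed.

(** The cost of predicting [Z_t] from [B] alone when [A] is revealed too. After multiplication by
    [n - #|A| - #|B|] the discrepancy is [#|A| * draw_prob B - treated A], a difference of two
    numbers in [[0, #|A|]]. *)
Lemma Expect_draw_extra A B u (t : 'I_n) : [disjoint A & B]%B ->
  depends_on (A :|: B) u -> t \notin A :|: B ->
  `|Expect D (fun z => u z * ((z t)%:R - draw_prob B z))|
    * (n%:R - #|A|%:R - #|B|%:R) <=
  #|A|%:R * Expect D (fun z => `|u z|).
Proof.
move=> AB uAB tAB; have := ltr_card tAB.
have cAB : #|A :|: B|%:R = #|A|%:R + #|B|%:R :> R.
  by rewrite cardsU disjoint_setI0 // cards0 subn0 natrD.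
have tB : t \notin B by apply: contra tAB; rewrite inE => ->; rewrite orbT.
have nB := ltr_card tB; rewrite cAB => nAB.
have N0 : 0 < n%:R - #|A|%:R - #|B|%:R :> R by lra.
rewrite -(gtr0_norm N0) -normrM mulrC.
under [Expect _ _]eq_Expect do rewrite mulrBr.
rewrite ExpectB mulrBr.
have -> : n%:R - #|A|%:R - #|B|%:R = n%:R - #|A :|: B|%:R :> R by rewrite cAB; ring.
rewrite Expect_draw // -[(_ - _) * Expect _ _]ExpectZ -ExpectB -ExpectZ.
apply: le_trans (normr_Expect _ _) _; apply: le_Expect => z Dz.
have -> : treated R (A :|: B) z = treated R A z + treated R B z.
  by rewrite /treated -bigU //=; apply: eq_bigl => j; rewrite !inE.
have -> : u z * (m%:R - (treated R A z + treated R B z)) -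
   (n%:R - #|A :|: B|%:R) * (u z * draw_prob B z) =
   u z * (#|A|%:R * draw_prob B z - treated R A z).
  rewrite cAB /draw_prob; field; lra.
rewrite normrM mulrC ler_wpM2r //.
have := draw_prob_ge0_le1 tB Dz; have := treated_ge0 R A z.
have := treated_le R A z; rewrite ler_norml; nra.
Qed.

(** The previous bound with nothing revealed in [B], where [draw_prob] is the unconditional
    [m / n]. *)
Lemma Expect_draw_bias A u (t : 'I_n) : depends_on A u -> t \notin A ->
  `|Expect D (fun z => u z * (z t)%:R) - m%:R / n%:R * Expect D u| * n%:R <=
  2 * #|A|%:R * Expect D (fun z => `|u z|).
Proof.
move=> uA tA; have nA := ltr_card tA.
have t0 : t \notin finset.set0 by rewrite inE.
have dpE z : draw_prob finset.set0 z = m%:R / n%:R.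
  by rewrite /draw_prob /treated big_set0 cards0 !subr0.
have /esym XE : Expect D (fun z => u z * ((z t)%:R - draw_prob finset.set0 z)) =
    Expect D (fun z => u z * (z t)%:R) - m%:R / n%:R * Expect D u.
  rewrite -ExpectZ -ExpectB; apply: eq_Expect => z _; rewrite dpE; ring.
rewrite XE.
have := @Expect_draw_extra A finset.set0 u t.
rewrite finset.setU0 cards0 subr0 -setI_eq0 finset.setI0 eqxx.
move=> /(_ isT uA tA).
set e := `|Expect D _|; set E := Expect D (fun z => `|u z|) => He.
have E0 : 0 <= E by apply: Expect_ge0.
have eE : e <= E.
  apply: le_trans (normr_Expect _ _) _; apply: le_Expect => z Dz.
  rewrite normrM ler_piMr //; have := draw_prob_ge0_le1 t0 Dz.
  by rewrite ler_norml; case: (z t); rewrite /=; lra.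
have e0 : 0 <= e by exact: normr_ge0.
have a0 : 0 <= #|A|%:R :> R by [].
(* If [2 #|A| <= n], then [n <= 2 (n - #|A|)], whence the factor 2; otherwise the trivial bound
   [e <= E] suffices. *)
have [?|?] := leP (2 * #|A|%:R) (n%:R : R).
  have : e * n%:R <= 2 * (e * (n%:R - #|A|%:R)) by nra.
  by nra.
by apply: le_trans (ler_wpM2r _ eE) _; nra.
Qed.

End SimpleRandomSample.

(** * Covariances of functions of disjoint sets of entries *)

Section Covariance.
Context (R : realType) (n : nat) (D : design R n) (m : nat) (w c V : R).
Hypothesis Dw : forall z, D z = if (\sum_i z i == m)%N then w else 0.
Hypotheses (c_gt0 : 0 < c) (c_le : c <= 2^-1).
Hypotheses (m_ge : c * n%:R <= m%:R) (m_le : m%:R <= (1 - c) * n%:R).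
Implicit Types (A B : {set 'I_n}) (f g : assignment n -> R).

(** Revealing at most [c n / 2] entries uses up at most half of the margin [c]. Staying away from 0
    and 1 is what lets the second moment of [g] control the effect on [g] of flipping one entry. *)
Lemma draw_prob_bounds B (t : 'I_n) (z : assignment n) : t \notin B ->
  2 * #|B|%:R <= c * n%:R -> c / 2 <= draw_prob R m B z <= 1 - c / 2.
Proof.
move=> tB Bn; have := @ltr_card R n B t tB; rewrite -subr_gt0 => N0.
have := treated_ge0 R B z; have := treated_le R B z => r1 r0;
have cb0 : 0 <= c * #|B|%:R by rewrite mulr_ge0 // ltW.
rewrite /draw_prob ler_pdivlMr // ler_pdivrMr //.
by move: m_ge m_le => mn nm; apply/andP; split; lra.
Qed.

(* Average out the entries of [B] one at a time: writing [g = G + h * (Z_t - pi)]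
   with [G] the conditional mean of [g] given the other entries of [B], the
   increment is uncorrelated with [G] and nearly uncorrelated with [f]. *)
Lemma cov_disjoint_small A f : depends_on A f -> 2 * #|A|%:R <= c * n%:R ->
  Expect D (fun z => f z ^+ 2) <= V ->
  forall b B g, #|B| = b -> 2 * b%:R <= c * n%:R -> [disjoint A & B]%B ->
    depends_on B g -> Expect D (fun z => g z ^+ 2) <= V ->
  `|Expect D (fun z => f z * g z) - Expect D f * Expect D g| * n%:R <=
  V * (1 + 4 / c ^+ 2) * #|A|%:R * b%:R.
Proof.
move: c_gt0 => c0 fA cA fV; elim=> [|b IH] B g cB bn AB gB gV.
  have B0 : B = finset.set0 by apply/eqP; rewrite -cards_eq0 cB.
  have gc z : g z = g [ffun=> false].
    by apply: gB => j; rewrite B0 inE.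
  have -> : Expect D (fun z => f z * g z) = Expect D f * Expect D g.
    under [X in _ * X]eq_Expect do rewrite gc.
    rewrite Expect_cst mulrC -ExpectZ; apply: eq_Expect => z _.
    by rewrite gc mulrC.
  by rewrite subrr normr0 mul0r mulr0.
have [t tB] : exists t, t \in B by apply/card_gt0P; rewrite cB.
have tB' : t \notin B :\ t by rewrite !inE eqxx.
have cB' : #|B :\ t| = b by move: (cardsD1 t B); rewrite tB cB => -[].
have AB' : [disjoint A & B :\ t]%B.
  by apply: disjointWr AB; exact: subD1set.
have tAB : t \notin A :|: B :\ t.
  by rewrite !inE eqxx orbF; apply: contraL tB => tA; rewrite (disjointFr AB).
have bn' : 2 * b%:R <= c * n%:R.
  by apply: le_trans bn; rewrite ler_pM2l // ler_nat.
pose g_ b z := g (insert_entry t b (delete_entry t z)).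
pose pi z := draw_prob R m (B :\ t) z.
pose h z := g_ true z - g_ false z.
pose G z := g_ false z + pi z * h z.
pose d (z : assignment n) := (z t)%:R - pi z.
have gE z : g z = G z + h z * d z.
  rewrite -{1}[z](set_entry_id t) /G /d /h /g_.
  by case: (z t); rewrite /=; ring.
have hB : depends_on (B :\ t) h.
  by move=> z z' zz'; rewrite /h /g_ !(depends_on_set_entry _ gB zz').
have GB : depends_on (B :\ t) G.
  move=> z z' zz'; rewrite /G /pi (hB _ _ zz') (draw_prob_dep _ _ zz').
  by rewrite /g_ !(depends_on_set_entry _ gB zz').
have centered u : depends_on (B :\ t) u -> Expect D (fun z => u z * d z) = 0.
  by move=> uB; exact: (Expect_draw_centered Dw).
have hd0 := centered _ hB.
have Ghd0 : Expect D (fun z => (G z * h z) * d z) = 0.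
  by apply: centered => z z' zz'; rewrite (hB _ _ zz') (GB _ _ zz').
(* [G] and [h * d] are orthogonal, so second moments add. Thus [G] inherits the bound [V], and the
   induction hypothesis applies to it. *)
have g2 : Expect D (fun z => g z ^+ 2) =
    Expect D (fun z => G z ^+ 2) + Expect D (fun z => (h z * d z) ^+ 2).
  rewrite -ExpectD -[RHS]addr0 -(mulr0 2) -Ghd0 -ExpectZ -ExpectD.
  by apply: eq_Expect => z _; rewrite gE; ring.
have G2V : Expect D (fun z => G z ^+ 2) <= V.
  apply: le_trans gV; rewrite g2 lerDl; apply: Expect_ge0 => z; exact: sqr_ge0.
(* Whatever [Z_t] is, [d] is at least [c / 2] in absolute value. *)
have h2V : Expect D (fun z => h z ^+ 2) <= V * (4 / c ^+ 2).
  have -> : V * (4 / c ^+ 2) = V / (c / 2) ^+ 2 by field; lra.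
  rewrite ler_pdivlMr ?exprn_gt0 ?divr_gt0 // mulrC -ExpectZ.
  apply: (@le_trans _ _ (Expect D (fun z => (h z * d z) ^+ 2))).
    apply: le_Expect => z _; rewrite [leRHS]exprMn [leRHS]mulrC ler_wpM2r ?sqr_ge0 //.
    have := @draw_prob_bounds (B :\ t) t z tB'; rewrite cB' => /(_ bn').
    rewrite /d /pi; set q := draw_prob _ _ _ _ => /andP[q0 q1].
    case: (z t); last by rewrite sub0r sqrrN lerXn2r ?nnegrE //; lra.
    by rewrite lerXn2r ?nnegrE //=; lra.
  apply: le_trans gV; rewrite g2 lerDr; apply: Expect_ge0 => z; exact: sqr_ge0.
have fh : Expect D (fun z => `|f z * h z|) <= V * (1 + 4 / c ^+ 2) / 2.
  have := normr_ExpectM D (fun z => `|f z|) (fun z => `|h z|).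
  under [X in `|X|]eq_Expect do rewrite -normrM.
  under [X in X + _]eq_Expect do rewrite real_normK ?num_real //.
  under [X in _ + X]eq_Expect do rewrite real_normK ?num_real //.
  by rewrite ger0_norm ?Expect_ge0 //; nra.
have fhAB : depends_on (A :|: B :\ t) (fun z => f z * h z).
  move=> z z' zz'; congr (_ * _).
    by apply: fA => j jA; apply: zz'; rewrite inE jA.
  by apply: hB => j jB; apply: zz'; rewrite inE jB orbT.
have extra := Expect_draw_extra Dw AB' fhAB tAB.
have fgE : Expect D (fun z => f z * g z) - Expect D f * Expect D g =
    (Expect D (fun z => f z * G z) - Expect D f * Expect D G)
    + Expect D (fun z => f z * h z * d z).
  have -> : Expect D g = Expect D G.
    rewrite -[RHS]addr0 -hd0 -ExpectD.
    by apply: eq_Expect => z _; rewrite gE.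
  rewrite addrAC -ExpectD; congr (_ - _).
  by apply: eq_Expect => z _; rewrite gE; ring.
have {}IH := IH _ G cB' bn' AB' GB G2V.
rewrite fgE; move: extra IH fh; rewrite cB'.
rewrite -[X in `|X| * (_ - _ - _)]/(Expect D (fun z => f z * h z * d z)).
set X := Expect D (fun z => f z * h z * d z).
set C := _ - Expect D f * Expect D G; set E := Expect D (fun z => `|f z * h z|).
set K := V * (1 + 4 / c ^+ 2) => extra IH fh.
have X0 : 0 <= `|X| := normr_ge0 X.
have a0 : 0 <= #|A|%:R :> R by [].
have cn : c * n%:R <= 2^-1 * n%:R by rewrite ler_wpM2r.
(* Since [c <= 1/2], [#|A|] and [b] are each at most [n / 4], so [n <= 2 (n - #|A| - b)]; this 2
   cancels the one in [fh]. Each entry of [B] thus costs [K * #|A|]. *)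
have Xn : `|X| * n%:R <= K * #|A|%:R.
  have : `|X| * n%:R <= 2 * (`|X| * (n%:R - #|A|%:R - b%:R)) by nra.
  by nra.
rewrite -natr1 mulrDr mulr1; apply: le_trans (lerD IH Xn).
by rewrite -mulrDl ler_wpM2r // ler_normD.
Qed.

Lemma cov_le f g : Expect D (fun z => f z ^+ 2) <= V ->
  Expect D (fun z => g z ^+ 2) <= V ->
  `|Expect D (fun z => f z * g z) - Expect D f * Expect D g| <= 2 * V.
Proof.
move=> fV gV; apply: le_trans (ler_normB _ _) _; rewrite normrM.
have := normr_ExpectM D f g.
have := sqr_Expect D f; have := sqr_Expect D g.
rewrite -(real_normK (num_real (Expect D f))) -(real_normK (num_real (Expect D g))).
have := sqr_ge0 (`|Expect D f| - `|Expect D g|); nra.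
Qed.

(** Removes the size restrictions of [cov_disjoint_small]: once one set has more than [c n / 2]
    elements and the other is nonempty, [#|A| * #|B|] is of order [n] and the crude bound [cov_le]
    is enough. *)
Lemma cov_disjoint A B f g : depends_on A f -> depends_on B g ->
  (0 < #|A|)%N -> (0 < #|B|)%N -> [disjoint A & B]%B ->
  Expect D (fun z => f z ^+ 2) <= V -> Expect D (fun z => g z ^+ 2) <= V ->
  `|Expect D (fun z => f z * g z) - Expect D f * Expect D g| * n%:R <=
  (V * (1 + 4 / c ^+ 2) + 4 * V / c) * (#|A|%:R * #|B|%:R).
Proof.
move: c_gt0 => c0 fA gB A0 B0 AB fV gV.
have a1 : 1 <= #|A|%:R :> R by rewrite ler1n.
have b1 : 1 <= #|B|%:R :> R by rewrite ler1n.
have V0 : 0 <= V by apply: le_trans fV; apply: Expect_ge0 => z; exact: sqr_ge0.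
have cv := cov_le fV gV.
have K0 : 0 <= V * (1 + 4 / c ^+ 2).
  by rewrite mulr_ge0 // addr_ge0 // divr_ge0 // sqr_ge0.
have L0 : 0 <= 4 * V / c by rewrite divr_ge0 ?mulr_ge0 // ltW.
have n0 : 0 <= n%:R :> R by [].
have large x y : c * n%:R <= 2 * x -> 1 <= y -> 1 <= x ->
    2 * V * n%:R <= 4 * V / c * (x * y).
  move=> cx y1 x1; apply: (@le_trans _ _ (4 * V / c * x)); last first.
    by rewrite ler_wpM2l // ler_peMr //; lra.
  have -> : 2 * V * n%:R = 2 * V / c * (c * n%:R) by field; lra.
  have -> : 4 * V / c * x = 2 * V / c * (2 * x) by ring.
  by rewrite ler_wpM2l // divr_ge0 ?mulr_ge0 // ltW.
have [cA|/ltW cA] := leP (2 * #|A|%:R) (c * n%:R); last first.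
  apply: (@le_trans _ _ (2 * V * n%:R)); first by rewrite ler_wpM2r.
  apply: le_trans (large _ _ cA b1 a1) _.
  by rewrite ler_wpM2r ?mulr_ge0 // lerDr.
have [cB|/ltW cB] := leP (2 * #|B|%:R) (c * n%:R); last first.
  apply: (@le_trans _ _ (2 * V * n%:R)); first by rewrite ler_wpM2r.
  apply: le_trans (large _ _ cB a1 b1) _.
  by rewrite [#|B|%:R * _]mulrC ler_wpM2r ?mulr_ge0 // lerDr.
apply: le_trans (cov_disjoint_small fA cA fV (erefl #|B|) cB AB gB gV) _.
by rewrite -[leLHS]mulrA ler_wpM2r ?mulr_ge0 // lerDl.
Qed.

End Covariance.

(** * Interference sets and the two averages built from them *)

Section Interference.
Context (R : realType) (n : nat) (y : outcomes R n).

Definition influencers (j : 'I_n) : {set 'I_n} := [set i | interferes y i j]%SET.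

Lemma influencers_self j : j \in influencers j.
Proof. by rewrite inE /interferes eqxx. Qed.

Lemma influencers_gt0 j : (0 < #|influencers j|)%N.
Proof. by apply/card_gt0P; exists j; exact: influencers_self. Qed.

Lemma delete_set_entry (t : 'I_n) b (z : assignment n) :
  delete_entry t (insert_entry t b (delete_entry t z)) = delete_entry t z.
Proof.
apply/ffunP => j; rewrite [LHS]ffunE set_entryE eq_sym.
by rewrite (negbTE (neq_lift _ _)) ffunE.
Qed.

(** [interferes] only compares assignments that differ at one entry. Induction on the number of
    disagreements between [z] and [z'] corrects them one at a time, each at a unit that does not
    affect [j]. *)
Lemma outcome_dep j : depends_on (influencers j) (y j).
Proof.
move=> z z'; have [d] := ubnP #|[set i | z i != z' i]%SET|.
elim: d z => // d IH z dz zz'.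
have [/finset.setP z0|[t tz]] := set_0Vmem [set i | z i != z' i]%SET.
  congr y; apply/ffunP => i; have := z0 i.
  by rewrite !inE => /negbFE/eqP.
move: (tz); rewrite inE => zt.
have tj : t \notin influencers j by apply: contraNN zt => /zz' ->.
pose z1 := insert_entry t (z' t) (delete_entry t z).
have -> : y j z = y j z1.
  apply/eqP; apply: contraNT tj => yz; rewrite inE /interferes.
  apply/orP; right; apply/existsP; exists z; apply/existsP; exists z1.
  by rewrite delete_set_entry eqxx.
apply: IH => [|i ij].
  rewrite -ltnS; apply: leq_trans dz; rewrite ltnS; apply: proper_card.
  apply/properP; split; last by exists t => //; rewrite inE set_entryE !eqxx.
  apply/fintype.subsetP => i; rewrite !inE set_entryE.
  by case: ifP => [/eqP ->|//]; rewrite eqxx.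
by rewrite set_entryE; case: eqP => [->//|_]; exact: zz'.
Qed.

Lemma outcome_at_dep i b : depends_on (influencers i :\ i) (outcome_at y i b).
Proof. exact: depends_on_set_entry (@outcome_dep i). Qed.

Lemma outcome_at_realized i (z : assignment n) : outcome_at y i (z i) z = y i z.
Proof. by rewrite /outcome_at set_entry_id. Qed.

Lemma independent_disjoint i j : ~~ dependent y i j ->
  [disjoint influencers i & influencers j]%B.
Proof.
move=> /existsPn dij; rewrite -setI_eq0; apply/eqP/finset.setP => l.
by rewrite !inE; apply/negbTE; exact: dij.
Qed.

Lemma avg_interferenceE : avg_interference y = n%:R^-1 * \sum_i #|influencers i|%:R.
Proof.
rewrite /avg_interference exchange_big; congr (_ * _); apply: eq_bigr => j _.
rewrite -natr_sum; congr _%:R; rewrite -sum1_card [RHS]big_mkcond /=.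
by apply: eq_bigr => i _; rewrite inE; case: interferes.
Qed.

Lemma avg_interference_ge0 : 0 <= avg_interference y.
Proof.
by rewrite avg_interferenceE mulr_ge0 // ?invr_ge0 // sumr_ge0.
Qed.

(** Every unit is dependent on itself. This keeps the rate positive, as Markov's inequality
    requires. *)
Lemma avg_dependence_ge1 : (0 < n)%N -> 1 <= avg_dependence y.
Proof.
move=> n0; rewrite /avg_dependence mulrC ler_pdivlMr ?ltr0n // mul1r.
rewrite -[n in leLHS]card_ord -sumr_const; apply: ler_sum => i _; rewrite (bigD1 i) //=.
have -> : dependent y i i.
  by apply/existsP; exists i; rewrite /interferes eqxx.
by rewrite lerDl sumr_ge0.
Qed.

End Interference.

(** * Integer moments from real-exponent moments *)

Section Moments.
Context (R : realType) (n : nat) (D : design R n).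

Lemma exprn_le_powR (x q : R) (r : nat) : 0 <= x -> r%:R <= q ->
  x ^+ r <= 1 + x `^ q.
Proof.
move=> x0 rq; have [x1|/ltW x1] := leP x 1.
  by apply: (@le_trans _ _ 1); rewrite ?exprn_ile1 // lerDl powR_ge0.
apply: (@le_trans _ _ (x `^ q)); last by rewrite lerDr.
by rewrite -powR_mulrn // ler_powR.
Qed.

(** Rescaling by [k] and integrating [x^r <= 1 + x^q] gives the factor 2, which stands in for
    Jensen's inequality. *)
Lemma moment_le (X : assignment n -> R) (k q : R) (r : nat) : 0 < k -> r%:R <= q ->
  Expect D (fun z => `|X z| `^ q) <= k `^ q ->
  Expect D (fun z => `|X z| ^+ r) <= 2 * k ^+ r.
Proof.
move=> k0 rq Xq; have kq0 : 0 < k `^ q by rewrite powR_gt0.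
have kr0 : 0 < k ^+ r by rewrite exprn_gt0.
apply: (@le_trans _ _ (Expect D (fun z => k ^+ r + k ^+ r / k `^ q * (`|X z| `^ q)))).
  apply: le_Expect => z _.
  have xk : `|X z| = k * (`|X z| / k) by rewrite mulrC divfK // gt_eqF.
  have x0 : 0 <= `|X z| / k by rewrite divr_ge0 // ltW.
  rewrite {1}xk exprMn {2}xk powRM // ?(ltW k0) // mulrA divfK ?gt_eqF //.
  by rewrite -{2}[k ^+ r]mulr1 -mulrDr ler_wpM2l ?(ltW kr0) // exprn_le_powR.
rewrite ExpectD Expect_cst ExpectZ mulrDl mul1r lerD2l mulrAC ler_pdivrMr //.
by rewrite ler_wpM2l // ltW.
Qed.

End Moments.

(** * Bias, covariances and mean squared error of the Horvitz-Thompson estimator *)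

Section MeanSquaredError.
Context (R : realType) (n : nat) (D : design R n) (y : outcomes R n).
Context (m : nat) (w k q s : R).
Hypothesis Dw : forall z, D z = if (\sum_i z i == m)%N then w else 0.
Hypotheses (k_gt0 : 0 < k) (q_ge2 : 2 <= q) (s_ge1 : 1 <= s).
Hypothesis reg : regular_at k q s D y.
Hypothesis n_gt0 : (0 < n)%N.

(** The draw identity with nothing revealed and [u = 1]. *)
Lemma treat_probE i : treat_prob D i = m%:R / n%:R.
Proof.
have n0 : n%:R != 0 :> R by rewrite pnatr_eq0 -lt0n.
have i0 : i \notin finset.set0 by rewrite inE.
have := @Expect_draw R n D m w Dw finset.set0 (fun=> 1) i (fun _ _ _ => erefl) i0.
rewrite cards0 subr0.
under [X in _ = X]eq_Expect do rewrite /treated big_set0 subr0 mul1r.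
rewrite Expect_cst => <-; rewrite mulrC mulKf //.
rewrite /treat_prob /Pr /Expect big_mkcond; apply: eq_bigr => z _.
by case: (z i); rewrite mul1r ?mulr1 ?mulr0.
Qed.

(** All units share the treatment probability [m / n], so the bound at one unit yields the margin
    [c = k^-1] of the covariance estimates. *)
Lemma share_bounds : k^-1 <= m%:R / n%:R <= 1 - k^-1.
Proof. by have [+ _ _] := reg (Ordinal n_gt0); rewrite treat_probE. Qed.

Definition ht_term i (z : assignment n) : R :=
  (z i)%:R * y i z / treat_prob D i
  - (1 - (z i)%:R) * y i z / (1 - treat_prob D i).

Definition unit_effect i : R :=
  Expect D (fun z => outcome_at y i true z - outcome_at y i false z).

Lemma ht_errorE z : tau_HT D y z - tau_EATE D y =
  n%:R^-1 * \sum_i (ht_term i z - unit_effect i).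
Proof. by rewrite /tau_HT /tau_EATE -!mulrBr -!sumrB. Qed.

Lemma ht_term_dep i : depends_on (influencers y i) (ht_term i).
Proof.
move=> z z' zz'; rewrite /ht_term (outcome_dep zz').
by rewrite (zz' i (influencers_self _ _)).
Qed.

(** For each [z] only one arm is nonzero, with weight at most [k]; the second moment of [Y_i] is at
    most [2 * k ^+ 2]. *)
Lemma ht_term_sqr i : Expect D (fun z => ht_term i z ^+ 2) <= 2 * k ^+ 4.
Proof.
have k0 := k_gt0.
have [_ Yq _] := reg i.
have -> : 2 * k ^+ 4 = k ^+ 2 * (2 * k ^+ 2) by ring.
have Y2 := moment_le k_gt0 q_ge2 Yq.
apply: (@le_trans _ _ (Expect D (fun z => k ^+ 2 * `|y i z| ^+ 2))); last first.
  by rewrite ExpectZ ler_wpM2l // sqr_ge0.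
apply: le_Expect => z _; rewrite real_normK ?num_real // -exprMn.
have /andP[p1 p2] := share_bounds.
have kp : 0 < k^-1 by rewrite invr_gt0.
have inv_bound x : k^-1 <= x -> x^-1 ^+ 2 <= k ^+ 2.
  move=> kx; have x0 : 0 < x by lra.
  have xk : x^-1 <= k by rewrite -[leRHS]invrK lef_pV2.
  by rewrite lerXn2r ?nnegrE ?invr_ge0 // ltW.
rewrite /ht_term treat_probE; case: (z i) => /=.
  rewrite mul1r subrr !mul0r subr0 mulrC !exprMn.
  by rewrite ler_wpM2r ?sqr_ge0 // inv_bound.
rewrite !mul0r subr0 mul1r sub0r sqrrN mulrC !exprMn.
by rewrite ler_wpM2r ?sqr_ge0 // inv_bound //; lra.
Qed.

Lemma ht_term_bias i : `|Expect D (ht_term i) - unit_effect i| * n%:R <=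
  8 * k ^+ 2 * #|influencers y i|%:R.
Proof.
have k0 := k_gt0; have /andP[p1 p2] := share_bounds.
have kp : 0 < k^-1 by rewrite invr_gt0.
have [_ _ Ys] := reg i.
set p : R := m%:R / n%:R in p1 p2.
have p0 : 0 < p by lra.
have p1' : 0 < 1 - p by lra.
pose f b := outcome_at y i b.
(* The covariance of [y_i(b; Z_{-i})] with [Z_i], which would vanish under independent assignment.
   The outcome is a function of entries other than [i], so [Expect_draw_bias] bounds it; the bias is
   a weighted sum of [e true] and [e false]. *)
pose e b := Expect D (fun z => f b z * (z i)%:R) - p * Expect D (f b).
have ti : i \notin influencers y i :\ i by rewrite !inE eqxx.
have ci : #|influencers y i :\ i|%:R <= #|influencers y i|%:R :> R.
  by rewrite ler_nat subset_leq_card // subD1set.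
have eb b : `|e b| * n%:R <= 4 * k * #|influencers y i|%:R.
  apply: le_trans (Expect_draw_bias Dw (@outcome_at_dep _ _ y i b) ti) _.
  have fb : Expect D (fun z => `|f b z|) <= 2 * k.
    by have := @moment_le _ _ _ _ k s 1 k0 s_ge1 (Ys b).
  have fb0 : 0 <= Expect D (fun z => `|f b z|) by apply: Expect_ge0.
  have c0 : 0 <= #|influencers y i :\ i|%:R :> R by [].
  rewrite -/(f b); nra.
have -> : Expect D (ht_term i) - unit_effect i = p^-1 * e true + (1 - p)^-1 * e false.
  have -> : Expect D (ht_term i) = p^-1 * Expect D (fun z => f true z * (z i)%:R)
     - (1 - p)^-1 * (Expect D (f false) - Expect D (fun z => f false z * (z i)%:R)).
    rewrite -ExpectB -!ExpectZ -ExpectB; apply: eq_Expect => z _.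
    rewrite /ht_term treat_probE -/p -(outcome_at_realized y i z) /f.
    by case: (z i) => /=; field; lra.
  by rewrite /unit_effect ExpectB /e -/(f true) -/(f false); field; lra.
have term x E : k^-1 <= x -> `|E| * n%:R <= 4 * k * #|influencers y i|%:R ->
    `|x^-1 * E| * n%:R <= 4 * k ^+ 2 * #|influencers y i|%:R.
  move=> kx En; have x0 : 0 < x by lra.
  have xk : x^-1 <= k by rewrite -[leRHS]invrK lef_pV2.
  have -> : 4 * k ^+ 2 * #|influencers y i|%:R = k * (4 * k * #|influencers y i|%:R).
    by ring.
  rewrite normrM ger0_norm ?invr_ge0 ?(ltW x0) // -[leLHS]mulrA.
  by apply: ler_pM; rewrite // ?invr_ge0 ?(ltW x0) ?mulr_ge0.
have T := term _ _ p1 (eb true); have p2' : k^-1 <= 1 - p by lra.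
have F := term _ _ p2' (eb false).
have := ler_normD (p^-1 * e true) ((1 - p)^-1 * e false).
move=> /(ler_wpM2r (ler0n R n)) /le_trans; apply.
by rewrite mulrDl; lra.
Qed.

(* Dependent pairs (second moments at most [2 * k ^+ 4]), then [cov_disjoint] with
   [V = 2 * k ^+ 4] and [c = k^-1], then the product of two biases. *)
Definition mse_const : R :=
  4 * k ^+ 4 + (2 * k ^+ 4 * (1 + 4 / k^-1 ^+ 2) + 4 * (2 * k ^+ 4) / k^-1)
  + 64 * k ^+ 4.

Lemma ht_terms_cov i j :
  Expect D (fun z => (ht_term i z - unit_effect i) * (ht_term j z - unit_effect j))
  <= mse_const * ((dependent y i j)%:R
                  + #|influencers y i|%:R * #|influencers y j|%:R / n%:R).
Proof.
have k0 := k_gt0; have /andP[p1 p2] := share_bounds.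
have kp : 0 < k^-1 by rewrite invr_gt0.
have kh : k^-1 <= 2^-1 by lra.
have n0 : 0 < n%:R :> R by rewrite ltr0n.
have n1 : 1 <= n%:R :> R by rewrite ler1n.
have mn1 : k^-1 * n%:R <= m%:R by rewrite -ler_pdivlMr.
have mn2 : m%:R <= (1 - k^-1) * n%:R by rewrite -ler_pdivrMr.
set a : R := #|influencers y i|%:R; set b : R := #|influencers y j|%:R.
have a0 : 0 <= a by [].
have b0 : 0 <= b by [].
rewrite Expect_mulB.
have := ht_term_bias i; have := ht_term_bias j.
set bi := Expect D (ht_term i) - _; set bj := Expect D (ht_term j) - _ => bjn bin.
(* The product is in fact of order [a b / n^2]; one factor [n >= 1] is given away to match the
   covariance bound. *)
have bias : bi * bj <= 64 * k ^+ 4 * (a * b / n%:R).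
  have -> : 64 * k ^+ 4 * (a * b / n%:R) =
      (8 * k ^+ 2 * a) * (8 * k ^+ 2 * b) / n%:R by field; rewrite gt_eqF.
  rewrite ler_pdivlMr //; apply: le_trans (ler_norm _) _.
  rewrite normrM normrM (ger0_norm (ltW n0)).
  apply: (@le_trans _ _ ((`|bi| * n%:R) * (`|bj| * n%:R))); last first.
    by apply: ler_pM => //; rewrite mulr_ge0.
  have -> : `|bi| * n%:R * (`|bj| * n%:R) = `|bi| * `|bj| * n%:R * n%:R by ring.
  by rewrite ler_peMr // !mulr_ge0.
have ab0 : 0 <= a * b / n%:R by rewrite !mulr_ge0 // invr_ge0 ltW.
have k40 : 0 <= k ^+ 4 by rewrite exprn_ge0 // ltW.
have Wi := ht_term_sqr i; have Wj := ht_term_sqr j.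
have K20 : 0 <= 2 * k ^+ 4 * (1 + 4 / k^-1 ^+ 2) + 4 * (2 * k ^+ 4) / k^-1.
  rewrite addr_ge0 // mulr_ge0 ?mulr_ge0 ?addr_ge0 ?mulr_ge0 ?invr_ge0 ?exprn_ge0 //;
  by rewrite ltW.
rewrite /mse_const; move: K20.
set K2 := 2 * k ^+ 4 * (1 + 4 / k^-1 ^+ 2) + 4 * (2 * k ^+ 4) / k^-1.
set x := a * b / n%:R in ab0 bias * => K20.
have x4 : 0 <= k ^+ 4 * x by rewrite mulr_ge0.
have [dij|dij] := boolP (dependent y i j).
  have := cov_le Wi Wj; rewrite ler_norml -[true%:R]/(1 : R) => /andP[_ cv].
  have Kx : 0 <= K2 * x by rewrite mulr_ge0.
  by lra.
have := cov_disjoint Dw kp kh mn1 mn2 (@ht_term_dep i) (@ht_term_dep j)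
  (influencers_gt0 y i) (influencers_gt0 y j) (independent_disjoint dij) Wi Wj.
rewrite -ler_pdivlMr // -[leRHS]mulrA -/a -/b -/x -/K2 ler_norml => /andP[_ cv].
by rewrite -[false%:R]/(0 : R); lra.
Qed.

Lemma ht_mse :
  Expect D (fun z => (tau_HT D y z - tau_EATE D y) ^+ 2) <=
  mse_const * (avg_dependence y / n%:R + avg_interference y ^+ 2 / n%:R).
Proof.
have n0 : n%:R != 0 :> R by rewrite pnatr_eq0 -lt0n.
pose u i z := ht_term i z - unit_effect i.
have -> : Expect D (fun z => (tau_HT D y z - tau_EATE D y) ^+ 2) =
    n%:R^-1 ^+ 2 * \sum_i \sum_j Expect D (fun z => u i z * u j z).
  transitivity (n%:R^-1 ^+ 2 * Expect D (fun z => \sum_i \sum_j u i z * u j z)).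
    rewrite -ExpectZ; apply: eq_Expect => z _.
    rewrite ht_errorE exprMn [(\sum_i _) ^+ 2]expr2 mulr_suml.
    by congr (_ * _); apply: eq_bigr => i _; rewrite mulr_sumr.
  rewrite Expect_sum; congr (_ * _); apply: eq_bigr => i _.
  by rewrite Expect_sum.
have -> : mse_const * (avg_dependence y / n%:R + avg_interference y ^+ 2 / n%:R) =
  n%:R^-1 ^+ 2 * \sum_i \sum_j mse_const * ((dependent y i j)%:R
                  + #|influencers y i|%:R * #|influencers y j|%:R / n%:R).
  (* The products of set sizes factor into the square of [n C_1], and the dependence indicators add
     up to [n d_avg]. *)
  have -> : \sum_i \sum_j mse_const * ((dependent y i j)%:R
      + #|influencers y i|%:R * #|influencers y j|%:R / n%:R) =
     mse_const * (n%:R * avg_dependence y + (n%:R * avg_interference y) ^+ 2 / n%:R).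
    rewrite avg_interferenceE /avg_dependence !mulVKf // expr2 mulr_suml mulr_suml.
    rewrite -big_split mulr_sumr; apply: eq_bigr => i _.
    rewrite mulr_sumr mulr_suml -big_split mulr_sumr; apply: eq_bigr => j _.
    by [].
  by field.
rewrite ler_wpM2l ?sqr_ge0 //; apply: ler_sum => i _; apply: ler_sum => j _.
exact: ht_terms_cov.
Qed.

(** With exactly [m] treated units and [p_i = m / n], both normalizing sums equal [n]. *)
Lemma hajek_eq_ht z : D z != 0 -> tau_HA D y z = tau_HT D y z.
Proof.
move=> Dz; have k0 := k_gt0; have /andP[p1 p2] := share_bounds.
have kp : 0 < k^-1 by rewrite invr_gt0.
have n0 : 0 < n%:R :> R by rewrite ltr0n.
have treated_sum : \sum_i (z i)%:R / treat_prob D i = n%:R.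
  under eq_bigr do rewrite treat_probE.
  rewrite -mulr_suml (support_treated Dw Dz) invf_div mulrC divfK // gt_eqF //.
  by rewrite -(pmulr_lgt0 _ (_ : 0 < n%:R^-1)) ?invr_gt0 //; lra.
have control_sum : \sum_i (1 - (z i)%:R) / (1 - treat_prob D i) = n%:R.
  under eq_bigr do rewrite treat_probE.
  rewrite -mulr_suml sumrB (support_treated Dw Dz) sumr_const card_ord.
  have -> : n%:R - m%:R = n%:R * (1 - m%:R / n%:R) :> R by field; lra.
  by rewrite mulfK // gt_eqF //; lra.
by rewrite /tau_HA treated_sum control_sum ![_ / n%:R]mulrC.
Qed.

End MeanSquaredError.

(** * From mean squared error to rates in probability *)

Section MarkovRate.
Context (R : realType) (D : forall n, design R n) (X : forall n, assignment n -> R).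
Context (K : R) (rate : nat -> R).
Hypothesis X_mse : \forall n \near \oo,
  0 < rate n /\ Expect (D n) (fun z => @X n z ^+ 2) <= K * rate n ^+ 2.

Lemma bigO_in_prob_mse : bigO_in_prob D X rate.
Proof.
(* Markov leaves [K / M^2 <= e] to check. As [M >= 1], [M^2 >= M >= |K| / e], so no square root is
   needed. *)
move=> e e0; pose M := `|K| / e + 1.
have Ke : 0 <= `|K| / e by rewrite divr_ge0 // ltW.
exists M; move: X_mse; apply: filterS => n [r0 Xn].
have M0 : 0 < M * rate n by rewrite mulr_gt0 // /M; lra.
apply: le_trans (markov_sqr _ _ M0) _.
rewrite ler_pdivrMr ?exprn_gt0 //; apply: le_trans Xn _.
rewrite exprMn [leRHS]mulrA ler_wpM2r ?sqr_ge0 //.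
apply: le_trans (ler_norm _) _.
have -> : `|K| = e * (`|K| / e) by rewrite mulrC divfK // gt_eqF.
by rewrite ler_wpM2l ?(ltW e0) // /M; nra.
Qed.

Lemma cvg_in_prob0_mse : rate n @[n --> \oo] --> (0 : R) -> cvg_in_prob0 D X.
Proof.
move=> rate0 e e0.
apply: (@squeeze_cvgr _ _ _ _ (fun=> 0) (fun n => K / e ^+ 2 * (rate n * rate n))).
- move: X_mse; apply: filterS => n [_ Xn]; apply/andP; split.
    by apply: sumr_ge0 => z _; exact: mass_ge0.
  apply: le_trans (markov_sqr _ _ e0) _.
  by rewrite -expr2 mulrAC ler_wpM2r // invr_ge0 sqr_ge0.
- exact: cvg_cst.
- rewrite -[X in _ --> X](mulr0 (K / e ^+ 2)); apply: cvgMr.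
  by rewrite -[X in _ --> X](mulr0 0); apply: cvgM.
Qed.

End MarkovRate.

(** * The rate: positivity, domination of the mean squared error, convergence to 0 *)

Section Rate.
Context (R : realType) (y : forall n : nat, outcomes R n).

Definition rate n : R :=
  (Num.sqrt n%:R)^-1 * Num.sqrt (avg_dependence (@y n))
  + (Num.sqrt n%:R)^-1 * avg_interference (@y n).

Lemma rate_gt0 n : (0 < n)%N -> 0 < rate n.
Proof.
move=> n0; have d1 := avg_dependence_ge1 (@y n) n0.
apply: ltr_wpDr; first by rewrite mulr_ge0 ?avg_interference_ge0.
by rewrite mulr_gt0 ?invr_gt0 ?sqrtr_gt0 ?ltr0n //; lra.
Qed.

(** The left side is the square on the right without its nonnegative cross term. *)
Lemma rate_sqr_ge n : (0 < n)%N ->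
  avg_dependence (@y n) / n%:R + avg_interference (@y n) ^+ 2 / n%:R <= rate n ^+ 2.
Proof.
move=> n0; have d1 := avg_dependence_ge1 (@y n) n0.
have c0 := avg_interference_ge0 (@y n).
rewrite /rate; move: (avg_dependence _) (avg_interference _) d1 c0 => d a d1 a0.
rewrite sqrrD !exprMn exprVn !sqr_sqrtr //; last by lra.
by rewrite ![n%:R^-1 * _]mulrC addrAC lerDl mulrn_wge0 // !mulr_ge0.
Qed.

Lemma cvg_rate :
  (fun n : nat => avg_dependence (@y n) : R^o) =o_\oo (fun n : nat => n%:R : R^o) ->
  (fun n : nat => avg_interference (@y n) : R^o) =o_\oo
    (fun n : nat => Num.sqrt n%:R : R^o) ->
  rate n @[n --> \oo] --> (0 : R).
Proof.
move=> /eqoP hd /eqoP hC; apply/cvgrPdist_le => e e0.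
have e2 : 0 < e / 2 by lra.
near=> n.
have n0 : (0 < n)%N by near: n; exact: nbhs_infty_gt.
have s0 : 0 < Num.sqrt n%:R :> R by rewrite sqrtr_gt0 ltr0n.
(* The tolerance is squared because [d_avg] enters the rate through its square root. *)
have d1 : `|avg_dependence (@y n)| <= (e / 2) ^+ 2 * `|n%:R : R|.
  by near: n; apply: hd; rewrite exprn_gt0.
have c1 : `|avg_interference (@y n)| <= e / 2 * `|Num.sqrt n%:R : R|.
  by near: n; apply: hC.
rewrite sub0r normrN gtr0_norm ?rate_gt0 // /rate -mulrDr mulrC ler_pdivrMr //.
have c2 := le_trans (ler_norm _) c1; rewrite (gtr0_norm s0) in c2.
have d2 : Num.sqrt (avg_dependence (@y n)) <= e / 2 * Num.sqrt n%:R.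
  have -> : e / 2 * Num.sqrt n%:R = Num.sqrt ((e / 2) ^+ 2 * n%:R).
    by rewrite sqrtrM ?sqr_ge0 // sqrtr_sqr ger0_norm // ltW.
  apply: ler_wsqrtr; apply: le_trans (ler_norm _) _.
  by rewrite (le_trans d1) // ger0_norm.
lra.
Unshelve. all: by end_near.
Qed.

End Rate.

(** * Consistency and rates for both estimators *)

Theorem proposition3 (R : realType) (p : R) (hp : 0 < p < 1)
    (D : forall n : nat, design R n) (y : forall n : nat, outcomes R n)
    (hD : forall n : nat, complete_randomization p (D n))
    (hreg : regularity_conditions D y)
    (hd : (fun n : nat => avg_dependence (y n) : R^o) =o_\oo (fun n : nat => n%:R : R^o))
    (hC : (fun n : nat => avg_interference (y n) : R^o) =o_\oo
          (fun n : nat => Num.sqrt n%:R : R^o)) :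
  let err_HT (n : nat) (z : assignment n) :=
    tau_HT (D n) (y n) z - tau_EATE (D n) (y n) in
  let err_HA (n : nat) (z : assignment n) :=
    tau_HA (D n) (y n) z - tau_EATE (D n) (y n) in
  let rate (n : nat) : R :=
    (Num.sqrt n%:R)^-1 * Num.sqrt (avg_dependence (y n))
    + (Num.sqrt n%:R)^-1 * avg_interference (y n) in
  [/\ cvg_in_prob0 D err_HT, cvg_in_prob0 D err_HA,
      bigO_in_prob D err_HT rate & bigO_in_prob D err_HA rate].
Proof.
have [k [q [s [k0 q2 s1 reg]]]] := hreg.
move=> err_HT err_HA rate.
have K0 : 0 <= mse_const k.
  have kp : 0 < k^-1 by rewrite invr_gt0.
  by rewrite /mse_const !addr_ge0 ?mulr_ge0 ?addr_ge0 ?mulr_ge0 ?invr_ge0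
    ?exprn_ge0 ?(ltW k0) ?(ltW kp).
have HT : \forall n \near \oo, 0 < rate n /\
    Expect (D n) (fun z => err_HT n z ^+ 2) <= mse_const k * rate n ^+ 2.
  near=> n.
  have n0 : (0 < n)%N by near: n; exact: nbhs_infty_gt.
  have rn : regular_at k q s (D n) (y n) by near: n.
  split; first exact: rate_gt0.
  apply: le_trans (ht_mse (hD n) k0 q2 s1 rn n0) _.
  by rewrite ler_wpM2l // rate_sqr_ge.
have HA : \forall n \near \oo, 0 < rate n /\
    Expect (D n) (fun z => err_HA n z ^+ 2) <= mse_const k * rate n ^+ 2.
  near=> n.
  have n0 : (0 < n)%N by near: n; exact: nbhs_infty_gt.
  have rn : regular_at k q s (D n) (y n) by near: n.
  have [r0 ?] : 0 < rate n /\
    Expect (D n) (fun z => err_HT n z ^+ 2) <= mse_const k * rate n ^+ 2 by near: n.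
  (* The two errors can differ only where [D n] has no mass, so the Horvitz-Thompson bound carries
     over. *)
  split=> //; rewrite (@eq_Expect _ _ _ _ (fun z => err_HT n z ^+ 2)) // => z Dz.
  by rewrite /err_HA (hajek_eq_ht (hD n) k0 rn n0 Dz).
have rate0 := cvg_rate hd hC.
split.
- exact: cvg_in_prob0_mse HT rate0.
- exact: cvg_in_prob0_mse HA rate0.
- exact: bigO_in_prob_mse HT.
- exact: bigO_in_prob_mse HA.
Unshelve. all: by end_near.
Qed.
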